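(* As $T\to0$, $V_T^\infty\sim\sqrt{2T\log(1/T)}$, i.e. $\displaystyle\lim_{T\downarrow0}\frac{V_T^\infty}{\sqrt{2T\log(1/T)}}=1$.
   Context: For $T>0$, on a probability space hosting a one-dimensional standard Brownian motion $B=(B(t))_{0\le t\le T}$, define $$V_T^\infty=\inf\Big\{\Big\|\int_0^T\alpha(t)\,dt+B(T)\Big\|_\infty:\ \|\alpha(t)\|_2\le\sqrt{2/\pi}\ \text{ for all }t\in[0,T]\Big\},$$ where the infimum is over real-valued processes $\alpha$ progressively measurable with respect to the filtration of $B$ satisfying the displayed constraint. Here $\|X\|_2=\mathbb{E}[X^2]^{1/2}$ and $\|X\|_\infty=\operatorname{ess\,sup}|X|$. *)

(* Defs.v *)
From HB Require Import structures.
From mathcomp Require Import all_boot all_order all_algebra.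
From mathcomp Require Import all_classical all_reals all_analysis.

Set Implicit Arguments.
Unset Strict Implicit.
Unset Printing Implicit Defensive.

Import Order.TTheory GRing.Theory Num.Theory.
Import numFieldNormedType.Exports.

Local Open Scope classical_set_scope.
Local Open Scope ring_scope.

(* A process indexed by [0, T] is a function of type R -> Omega -> R; its
   values at times outside [0, T] are never constrained nor used. *)

(* The sets {X(s) \in A} for 0 <= s <= t and A Borel. *)
Definition natural_generators d (Omega : measurableType d) (R : realType)
    (X : R -> Omega -> R) (t : R) : set (set Omega) :=
  \bigcup_(s in `[0, t]) preimage_set_system setT (X s) measurable.

(* F_t = sigma(X(s), 0 <= s <= t); this is also the sigma-algebra carried by
   the type g_sigma_algebraType (natural_generators X t). *)
Definition natural_filtration d (Omega : measurableType d) (R : realType)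
    (X : R -> Omega -> R) (t : R) : set (set Omega) :=
  <<s natural_generators X t >>.

(* The parameter s of normal_prob m s is the standard deviation. *)
Definition brownian_motion d (Omega : measurableType d) (R : realType)
    (P : probability Omega R) (T : R) (B : R -> Omega -> R) : Prop :=
  [/\ forall t : R, t \in `[0, T] -> measurable_fun setT (B t),
      {ae P, forall w, B 0 w = 0},
      forall s t : R, 0 <= s -> s < t -> t <= T ->
        forall A : set R, measurable A ->
          P ((B t \- B s) @^-1` A) = normal_prob 0 (Num.sqrt (t - s)) A,
      forall s t : R, 0 <= s -> s < t -> t <= T ->
        forall (F : set Omega) (A : set R),
          natural_filtration B s F -> measurable A ->
          P (F `&` (B t \- B s) @^-1` A) =
            (P F * P ((B t \- B s)%R @^-1` A))%E
    & {ae P, forall w, {within `[0, T], continuous (B ^~ w)}}].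

(* For all t in [0, T], alpha restricted to [0, t] x Omega is measurable for
   the product of the Borel sigma-algebra of [0, t] and F_t. *)
Definition progressively_measurable d (Omega : measurableType d)
    (R : realType) (T : R) (B alpha : R -> Omega -> R) : Prop :=
  forall t : R, t \in `[0, T] ->
    measurable_fun
      (`[0, t] `*` setT :
        set (R * g_sigma_algebraType (natural_generators B t)))
      (fun p => alpha p.1 p.2).

Definition admissible d (Omega : measurableType d) (R : realType)
    (P : probability Omega R) (T : R) (B alpha : R -> Omega -> R) : Prop :=
  progressively_measurable T B alpha /\
  forall t : R, t \in `[0, T] ->
    ('N[P]_2%:E [EFin \o alpha t] <= (Num.sqrt (2 / pi))%:E)%E.

(* By Fubini, t |-> alpha t w is integrable on [0, T] for almost all w when
   alpha is admissible, so that the convention Rintegral = 0 for functions that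
   are not integrable does not affect the L^oo norm. *)
Definition terminal_value d (Omega : measurableType d) (R : realType)
    (T : R) (B alpha : R -> Omega -> R) (w : Omega) : R :=
  (\int[lebesgue_measure]_(t in `[0, T]) alpha t w) + B T w.

Definition V_oo d (Omega : measurableType d) (R : realType)
    (P : probability Omega R) (T : R) (B : R -> Omega -> R) : \bar R :=
  ereal_inf [set 'N[P]_+oo [EFin \o terminal_value T B alpha]%E
            | alpha in admissible P T B].

(* Main.v *)
(** Lower bound. By Tonelli, the mean energy E[int alpha^2] is at most (2/pi) T.
    If the terminal value is a.s. at most L, then on the event
    [B T - B 0 >= L + sqrt T] the drift has to bring the process down by sqrt T,
    which costs an energy at least 1 by Cauchy-Schwarz. So this event has
    probability at most (2/pi) T, and the Gaussian tail forces
    L >= sqrt T (sqrt (2 ln (1/T)) - 4).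

    Upper bound. On the grid t_k = T (1 - rho^k), the control used over
    [t_k, t_(k+1)[ is constant and brings the process back to [-L_k, L_k], where
    L_(k+1) = L_k + a_k. The excess to be corrected at time t_(k+1) is at most
    (|B t_(k+1) - B t_k| - a_k)^+, whose second moment is bounded by an
    exponential tilting of the Gaussian density. For rho = r^2 / 2 and
    a_k = r^k sqrt (2 T ln (1/T)) the control is admissible as soon as T is small,
    and since t_k tends to T the terminal value is a.s. at most
    sum_k a_k = sqrt (2 T ln (1/T)) / (1 - r). Letting r tend to 0 concludes. *)

Require Import Defs.
From HB Require Import structures.
From mathcomp Require Import all_boot all_order all_algebra.
From mathcomp Require Import all_classical all_reals all_analysis.
From mathcomp Require Import measurable_realfun ess_sup_inf ring lra.

Set Implicit Arguments.
Unset Strict Implicit.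
Unset Printing Implicit Defensive.

Import Order.TTheory GRing.Theory Num.Theory.
Import numFieldNormedType.Exports.

Local Open Scope classical_set_scope.
Local Open Scope ring_scope.

(** * Gaussian tail estimates *)

(** The change of variables is available for the Radon-Nikodym derivative; [normal_pdf] has the same
    integral over every measurable set, so the two densities agree almost everywhere. *)
Lemma ge0_integral_normal_prob (R : realType) (m s : R) (f : R -> \bar R) :
  measurable_fun [set: R] f -> (forall x, 0 <= f x)%E ->
  (\int[normal_prob m s]_x f x =
   \int[lebesgue_measure]_x (f x * (normal_pdf m s x)%:E))%E.
Proof.
move=> mf f0.
have dom := normal_prob_dominates m s.
rewrite -(Radon_Nikodym_SigmaFinite.change_of_variables dom)//.
have mg : measurable_fun [set: R] (EFin \o normal_pdf m s).
  by apply/measurable_EFinP; exact: measurable_normal_pdf.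
have ig := Radon_Nikodym_SigmaFinite.f_integrable dom.
apply: ae_eq_integral => //.
- by apply: emeasurable_funM => //; exact: measurable_int ig.
- exact: emeasurable_funM.
- apply: ae_eqe_mul2l; apply: integral_ae_eq => // A _ mA.
  by rewrite -(Radon_Nikodym_SigmaFinite.f_integral dom).
Qed.

Lemma normal_pdf_sd_gt0E (R : realType) (m s x : R) : 0 < s ->
  normal_pdf m s x = normal_peak s * expR (- (x - m) ^+ 2 / (s ^+ 2 *+ 2)).
Proof. by move=> s0; rewrite normal_pdfE ?gt_eqF. Qed.

Lemma normal_peakE (R : realType) (s : R) : 0 < s ->
  normal_peak s = (s * Num.sqrt (2 * pi))^-1.
Proof.
move=> s0; rewrite /normal_peak; congr (_^-1).
rewrite -mulr_natr -mulrA [pi * _]mulrC sqrtrM ?sqr_ge0// sqrtr_sqr.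
by rewrite gtr0_norm.
Qed.

(** On this interval the density is at least its value at the right endpoint; the length [s] cancels
    the factor [s] of the peak. *)
Lemma normal_prob_itv_ge (R : realType) (s x : R) : 0 < s -> 0 <= x ->
  ((expR (- (x + s) ^+ 2 / (s ^+ 2 *+ 2)) / Num.sqrt (2 * pi))%:E
    <= normal_prob 0 s `[x, (x + s)%R])%E.
Proof.
move=> s0 x0.
set c := expR _.
have -> : ((c / Num.sqrt (2 * pi))%:E =
   \int[lebesgue_measure]_(y in `[x, (x + s)%R]) (normal_peak s * c)%:E)%E.
  rewrite integral_cst//= lebesgue_measure_itv/= lte_fin ltrDl s0 -EFinB -EFinM.
  congr EFin; rewrite normal_peakE//; field.
  by rewrite ?gt_eqF//= ?sqrtr_gt0 mulr_gt0 ?pi_gt0.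
apply: ge0_le_integral => //=.
- by move=> y _; rewrite lee_fin mulr_ge0 ?normal_peak_ge0 ?expR_ge0.
- by apply/measurable_EFinP/measurable_funTS; exact: measurable_normal_pdf.
- move=> y; rewrite in_itv/= => /andP[xy yx].
  rewrite lee_fin normal_pdf_sd_gt0E// ler_wpM2l ?normal_peak_ge0// ler_expR.
  rewrite ler_pM2r ?invr_gt0 ?pmulrn_lgt0 ?exprn_gt0// lerN2 subr0.
  by rewrite ler_sqr ?nnegrE// ?addr_ge0 ?(ltW s0)// (le_trans x0).
Qed.

Lemma sqr_le_expR (R : realType) (x : R) : 0 <= x -> x ^+ 2 <= 2 * expR x.
Proof.
by move=> x0; have := expR_ge1Dxn 1 x0; rewrite !factS fact0 !muln1; lra.
Qed.

(** Scaling in [sqr_le_expR] gives exponentials of rate [a / v]; one exponential per sign of [y]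
    removes the absolute value. With [v] the variance, this rate is the one that moves a centred
    Gaussian to mean [a]. *)
Lemma sqr_excess_le_expR (R : realType) (v a y : R) : 0 < v -> 0 < a ->
  Num.max 0 (`|y| - a) ^+ 2 <=
  2 * v ^+ 2 / a ^+ 2 * (expR (a / v * (y - a)) + expR (a / v * (- y - a))).
Proof.
move=> v0 a0.
have av : 0 < a / v by rewrite divr_gt0.
have key z : 0 <= z ->
    z ^+ 2 <= 2 * v ^+ 2 / a ^+ 2 * expR (a / v * z).
  move=> z0; have h : 0 <= a / v * z by rewrite mulr_ge0// ltW.
  have -> : z ^+ 2 = v ^+ 2 / a ^+ 2 * (a / v * z) ^+ 2.
    by field; rewrite ?gt_eqF// gt_eqF.
  rewrite [leRHS](_ : _ = v ^+ 2 / a ^+ 2 * (2 * expR (a / v * z))); last by ring.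
  by rewrite ler_wpM2l ?sqr_le_expR// divr_ge0 ?sqr_ge0.
have c0 : 0 <= 2 * v ^+ 2 / a ^+ 2.
  by apply: divr_ge0; [apply: mulr_ge0 => //|]; exact: sqr_ge0.
rewrite mulrDr; have [h|h] := leP (`|y| - a) 0.
  by rewrite expr0n/= addr_ge0// mulr_ge0 ?expR_ge0.
have [y0|y0] := leP 0 y; move: h; rewrite ?(ger0_norm y0) ?(ltr0_norm y0) => h.
  by rewrite (le_trans (key _ (ltW h)))// lerDl mulr_ge0 ?expR_ge0.
by rewrite (le_trans (key _ (ltW h)))// lerDr mulr_ge0 ?expR_ge0.
Qed.

(** Exponential tilting: completing the square in the exponent. *)
Lemma normal_pdf_tilt (R : realType) (s a y : R) : 0 < s ->
  expR (a / s ^+ 2 * (y - a)) * normal_pdf 0 s y =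
  expR (- a ^+ 2 / (s ^+ 2 *+ 2)) * normal_pdf a s y.
Proof.
move=> s0; rewrite !normal_pdf_sd_gt0E// ![_ * (normal_peak _ * _)]mulrCA.
congr (_ * _); rewrite -!expRD; congr expR.
by rewrite -mulr_natr; field; rewrite gt_eqF.
Qed.

(** After tilting, the two exponentials become Gaussian densities centred at [a] and [- a], each of
    mass 1; hence 4 = 2 * 2. *)
Lemma normal_prob_excess_le (R : realType) (s a : R) : 0 < s -> 0 < a ->
  (\int[normal_prob 0 s]_y (Num.max 0 (`|y| - a) ^+ 2)%:E <=
   (4 * s ^+ 4 / a ^+ 2 * expR (- a ^+ 2 / (s ^+ 2 *+ 2)))%:E)%E.
Proof.
move=> s0 a0.
pose c := 2 * s ^+ 4 / a ^+ 2 * expR (- a ^+ 2 / (s ^+ 2 *+ 2)).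
have c0 : 0 <= c by rewrite mulr_ge0 ?expR_ge0// divr_ge0 ?mulr_ge0 ?exprn_ge0 ?ltW.
have mf : measurable_fun [set: R] (fun y : R => (Num.max 0 (`|y| - a) ^+ 2)%:E).
  apply/measurable_EFinP; apply: measurable_funX; apply: measurable_maxr => //.
  by apply: measurable_funB => //; exact: measurable_normr.
have mp b : measurable_fun [set: R] (fun y => (normal_pdf b s y)%:E).
  by apply/measurable_EFinP; exact: measurable_normal_pdf.
rewrite ge0_integral_normal_prob//; last by move=> y; rewrite lee_fin sqr_ge0.
have -> : (4 * s ^+ 4 / a ^+ 2 * expR (- a ^+ 2 / (s ^+ 2 *+ 2)))%:E =
    (\int[lebesgue_measure]_y
      (c%:E * ((normal_pdf a s y)%:E + (normal_pdf (- a) s y)%:E)))%E.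
  rewrite ge0_integralZl ?lee_fin//=; last 2 first.
  - by apply: emeasurable_funD; exact: mp.
  - by move=> y _; rewrite adde_ge0// lee_fin normal_pdf_ge0.
  rewrite ge0_integralD//; try exact: mp;
    try by move=> y _; rewrite lee_fin normal_pdf_ge0.
  by rewrite !integral_normal_pdf -EFinD -EFinM; congr EFin; rewrite /c; ring.
apply: ge0_le_integral => //.
- by move=> y _; rewrite -EFinM lee_fin mulr_ge0 ?sqr_ge0 ?normal_pdf_ge0.
- by apply: emeasurable_funM => //; exact: mp.
- by apply: emeasurable_funM => //; apply: emeasurable_funD; exact: mp.
- move=> y _; rewrite -EFinD -!EFinM lee_fin.
  have s20 : 0 < s ^+ 2 by rewrite exprn_gt0.
  have := ler_wpM2r (normal_pdf_ge0 0 s y) (sqr_excess_le_expR y s20 a0).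
  move=> /le_trans; apply.
  rewrite -[leLHS]mulrA [X in _ * X]mulrDl normal_pdf_tilt//.
  have -> : a / s ^+ 2 * (- y - a) = (- a) / s ^+ 2 * (y - - a) by ring.
  rewrite normal_pdf_tilt// sqrrN /c.
  by rewrite le_eqVlt; apply/orP; left; apply/eqP; ring.
Qed.

(** * Energy of admissible controls *)

Lemma measurable_natural_filtration d (Omega : measurableType d) (R : realType)
    (X : R -> Omega -> R) (T : R) :
  (forall t, t \in `[0, T] -> measurable_fun setT (X t)) ->
  natural_filtration X T `<=` measurable.
Proof.
move=> mX; apply: smallest_sub.
  exact: sigma_algebra_measurable.
move=> _ [s /= sT [A mA <-]].
by apply: mX => //; exact: sT.
Qed.

(** At time [T], progressive measurability is joint measurability for a sigma-algebra contained in
    the ambient one. Tonelli needs the ambient one. *)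
Lemma measurable_progressive d (Omega : measurableType d) (R : realType)
    (T : R) (B alpha : R -> Omega -> R) : 0 <= T ->
  (forall t, t \in `[0, T] -> measurable_fun setT (B t)) ->
  progressively_measurable T B alpha ->
  measurable_fun (`[0, T] `*` setT : set (R * Omega)) (fun p => alpha p.1 p.2).
Proof.
move=> T0 mB /(_ T); rewrite in_itv/= T0 lexx => /(_ isT).
set D := (X in measurable_fun X _) => malpha.
have mD : measurable D by apply: measurableX.
have mD' : measurable (`[0, T] `*` setT : set (R * Omega)) by apply: measurableX.
move/(measurable_restrictT _ mD) : malpha => malpha.
apply/(measurable_restrictT _ mD').
(* The identity, seen as a map from the ambient sigma-algebra to the coarser one. *)
pose i (p : R * Omega) : R * g_sigma_algebraType (natural_generators B T) :=
  (p.1, p.2).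
have mi : measurable_fun setT i.
  apply: measurable_fun_pair; first exact: measurable_fst.
  move=> _ A mA; rewrite setTI.
  rewrite -[X in measurable X]setTI; apply: measurable_snd => //.
  exact: (measurable_natural_filtration mB).
exact: (measurableT_comp malpha mi).
Qed.

Lemma Lnorm2_le d (Omega : measurableType d) (R : realType)
    (P : {measure set Omega -> \bar R}) (f : Omega -> R) (c : R) : 0 <= c ->
  ('N[P]_2%:E [EFin \o f] <= c%:E)%E <->
  (\int[P]_w (f w ^+ 2)%:E <= (c ^+ 2)%:E)%E.
Proof.
move=> c0.
have <- : ('N[P]_2%:E [EFin \o f] `^ 2)%E = (\int[P]_w (f w ^+ 2)%:E)%E.
  rewrite poweR_Lnorm//; apply: eq_integral => w _ /=.
  by rewrite powR_mulrn// real_normK// num_real.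
have := @Lnorm_ge0 _ _ _ P 2%:E (EFin \o f).
case: ('N[P]_2%:E [EFin \o f])%E => [x|_|//]; last first.
  by rewrite poweRyr ?pnatr_eq0// !leye_eq.
by rewrite lee_fin => x0; rewrite poweR_EFin powR_mulrn// !lee_fin ler_sqr.
Qed.

Section admissible.
Context d (Omega : measurableType d) (R : realType) (P : probability Omega R).
Variables (T : R) (B alpha : R -> Omega -> R).
Hypothesis T0 : 0 < T.
Hypothesis mB : forall t, t \in `[0, T] -> measurable_fun setT (B t).
Hypothesis adm : admissible P T B alpha.

Let malpha := measurable_progressive (ltW T0) mB adm.1.

Lemma measurable_admissible_path w :
  measurable_fun (`[0, T] : set R) (fun t => alpha t w).
Proof.
have mD : measurable (`[0, T] `*` setT : set (R * Omega)) by apply: measurableX.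
have /(measurable_restrictT _ mD) h0 := malpha.
have h := measurable_fun_pair1 w h0.
apply/(measurable_restrictT _ _) => //.
apply: eq_measurable_fun h => t _ /=.
rewrite !patchE; congr (if _ then _ else _).
by apply/idP/idP; rewrite !inE /= => -[].
Qed.

(** Extended by zero outside [[0, T]], so that Tonelli applies on the whole product space. *)
Let energy := fun p : R * Omega =>
  (((fun p => alpha p.1 p.2 ^+ 2) \_ (`[0, T] `*` setT)) p)%:E.

Let menergy : measurable_fun setT energy.
Proof.
have mD : measurable (`[0, T] `*` setT : set (R * Omega)) by apply: measurableX.
apply/measurable_EFinP/(measurable_restrictT _ mD).
exact: measurable_funX.
Qed.

Let energy_ge0 p : (0 <= energy p)%E.
Proof. by rewrite /energy patchE; case: ifP => // _; rewrite lee_fin sqr_ge0. Qed.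

Let energyE w : (\int[lebesgue_measure]_t energy (t, w) =
  \int[lebesgue_measure]_(t in `[0%R, T]) (alpha t w ^+ 2)%:E)%E.
Proof.
rewrite [RHS]integral_mkcond; apply: eq_integral => t _.
rewrite /energy !patchE.
have -> : ((t, w) \in (`[0, T] `*` setT : set (R * Omega))) =
    (t \in [set` Interval (BLeft 0) (BRight T)]).
  by apply/idP/idP; rewrite !inE /= => // -[].
by case: ifP.
Qed.

Lemma measurable_admissible_energy : measurable_fun [set: Omega]
  (fun w => \int[lebesgue_measure]_(t in `[0%R, T]) (alpha t w ^+ 2)%:E)%E.
Proof.
have := measurable_fun_fubini_tonelli_G (m1 := @lebesgue_measure R) energy menergy
  energy_ge0.
by apply: eq_measurable_fun => w _; rewrite -energyE.
Qed.

(** By Tonelli, the constraint at each fixed time can be integrated over an interval of length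
    [T]. *)
Lemma admissible_energy_le :
  (\int[P]_w \int[lebesgue_measure]_(t in `[0%R, T]) (alpha t w ^+ 2)%:E <=
   (T * (2 / pi))%:E)%E.
Proof.
have c0 : 0 <= 2 / pi :> R by rewrite divr_ge0 ?pi_ge0.
under eq_integral do rewrite -energyE.
rewrite -(fubini_tonelli (m1 := @lebesgue_measure R) (m2 := P) energy)//.
have -> : ((T * (2 / pi))%:E =
    \int[lebesgue_measure]_(t in `[0%R, T]) (2 / pi)%:E :> \bar R)%E.
  by rewrite integral_cst//= lebesgue_measure_itv/= lte_fin T0 sube0 -EFinM mulrC.
rewrite [leRHS]integral_mkcond; apply: ge0_le_integral => //.
- by move=> t _; apply: integral_ge0 => w _; exact: energy_ge0.
- exact: measurable_fun_fubini_tonelli_F.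
- by apply/(measurable_restrictT (cst _)) => //; exact: measurable_cst.
- move=> t _; rewrite patchE; case: ifPn => tT.
    move: tT; rewrite inE/= => tT; have := adm.2 t tT.
    move/(Lnorm2_le _ _ (sqrtr_ge0 _)); rewrite sqr_sqrtr//; apply: le_trans.
    rewrite le_eqVlt; apply/orP; left; apply/eqP.
    by apply: eq_integral => w _; rewrite /energy patchE ifT// inE.
  rewrite integral0_eq// => w _.
  rewrite /energy patchE ifF//; apply/negbTE; apply: contra tT.
  by rewrite !inE/= => -[].
Qed.

End admissible.

(** Cauchy-Schwarz in linearized form, from [(sqrt T * |f t| - 1)^2 >= 0]. It also holds for
    infinite energy, and an energy below 1 keeps the left side below [sqrt T]. *)
Lemma integral_abs_le_energy (R : realType) (T : R) (f : R -> R) : 0 < T ->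
  measurable_fun (`[0, T] : set R) f ->
  (\int[lebesgue_measure]_(t in `[0%R, T]) `|f t|%:E <=
   (Num.sqrt T / 2)%:E *
   (\int[lebesgue_measure]_(t in `[0%R, T]) (f t ^+ 2)%:E + 1))%E.
Proof.
move=> T0 mf; set s := Num.sqrt T.
have s0 : 0 < s by rewrite sqrtr_gt0.
have sT : s ^+ 2 = T by rewrite sqr_sqrtr// ltW.
have -> : (1 = \int[lebesgue_measure]_(t in `[0%R, T]) (T^-1)%:E :> \bar R)%E.
  rewrite integral_cst//= lebesgue_measure_itv/= lte_fin T0 sube0 -EFinM mulVf//.
  by rewrite gt_eqF.
have mf2 : measurable_fun (`[0, T] : set R) (fun t => (f t ^+ 2)%:E).
  by apply/measurable_EFinP; exact: measurable_funX.
rewrite -ge0_integralD//; last 2 first.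
- by move=> t _; rewrite lee_fin sqr_ge0.
- by move=> t _; rewrite lee_fin invr_ge0 ltW.
rewrite -ge0_integralZl//; last 3 first.
- by apply: emeasurable_funD.
- by move=> t _; rewrite -EFinD lee_fin addr_ge0 ?sqr_ge0// invr_ge0 ltW.
- by rewrite lee_fin divr_ge0// ltW.
apply: ge0_le_integral => //.
- by apply/measurable_EFinP; exact: measurableT_comp.
- by apply: emeasurable_funM => //; exact: emeasurable_funD.
- move=> t _; rewrite -EFinD -EFinM lee_fin -sT.
  have := sqr_ge0 (s * `|f t| - 1); rewrite -[f t ^+ 2]real_normK ?num_real// => h.
  have -> : s / 2 * (`|f t| ^+ 2 + (s ^+ 2)^-1) =
     `|f t| + (s * `|f t| - 1) ^+ 2 / (2 * s) by field; rewrite gt_eqF.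
  by rewrite lerDl divr_ge0// mulr_ge0// ltW.
Qed.

(** * Lower bound *)

Section admissible_consequences.
Context d (Omega : measurableType d) (R : realType) (P : probability Omega R).
Variables (T : R) (B alpha : R -> Omega -> R).
Hypothesis T0 : 0 < T.
Hypothesis bB : brownian_motion P T B.
Hypothesis adm : admissible P T B alpha.

Let mB : forall t, t \in `[0, T] -> measurable_fun setT (B t).
Proof. by case: bB. Qed.

Let J w := (\int[lebesgue_measure]_(t in `[0%R, T]) (alpha t w ^+ 2)%:E)%E.

Let J0 w : (0 <= J w)%E.
Proof. by apply: integral_ge0 => t _; rewrite lee_fin sqr_ge0. Qed.

Let mJ : measurable_fun setT J.
Proof. exact: (measurable_admissible_energy T0 mB adm). Qed.

(** The energy has finite mean, hence is almost surely finite, and it controls the integral of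
    [|alpha|]. *)
Lemma admissible_integrable : {ae P, forall w,
  lebesgue_measure.-integrable `[0, T] (EFin \o alpha ^~ w)}.
Proof.
have iJ : P.-integrable setT J.
  apply/integrableP; split=> //.
  under eq_integral do rewrite gee0_abs//.
  exact: le_lt_trans (admissible_energy_le T0 mB adm) (ltry _).
apply: filterS (integrable_ae measurableT iJ) => w /(_ I) Jw.
have mw := measurable_admissible_path T0 mB adm w.
apply/integrableP; split; first exact/measurable_EFinP.
apply: le_lt_trans (integral_abs_le_energy T0 mw) _.
by rewrite -/(J w) -(fineK Jw) -EFinD -EFinM ltry.
Qed.

(** Almost surely the indicator of the event is at most the energy, whose mean is already bounded.
    The window has length [sqrt T], as in [normal_prob_itv_ge]. *)
Lemma increment_tail_le (L : R) :
  {ae P, forall w, `|terminal_value T B alpha w| <= L} ->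
  (P ((B T \- B 0)%R @^-1` `[(L + Num.sqrt T)%R, (L + Num.sqrt T + Num.sqrt T)%R])
   <= (T * (2 / pi))%:E)%E.
Proof.
move=> hL; set s := Num.sqrt T; set A := _ @^-1` _.
have s0 : 0 < s by rewrite sqrtr_gt0.
have mA : measurable A.
  rewrite -[A]setTI; apply: measurable_funB => //; apply: mB;
    by rewrite in_itv/= lexx (ltW T0).
rewrite -(setIT A) -integral_indic//.
apply: le_trans (admissible_energy_le T0 mB adm).
apply: ae_ge0_le_integral => //.
- exact/measurable_EFinP/measurable_indic.
- by move=> w _; exact: J0.
- case: bB => _ B0 _ _ _; apply: filterS2 hL B0 => w hw B0w _.
  rewrite indicE; have [|_] := boolP (w \in A); last exact: J0.
  rewrite inE /A/= in_itv/= B0w subr0 => /andP[Aw _].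
  have mw := measurable_admissible_path T0 mB adm w.
  rewrite -/(J w) leNgt; apply/negP => J1.
  have Jf : J w \is a fin_num by rewrite ge0_fin_numE// (lt_trans J1)// ltry.
  have := integral_abs_le_energy T0 mw; rewrite -/(J w) -/s.
  have := le_abse_integral lebesgue_measure (measurable_itv _)
    (iffRL (measurable_EFinP _ _) mw).
  move=> /le_trans /[apply].
  move: hw; rewrite /terminal_value /Rintegral.
  move: J1; rewrite -(fineK Jf) lte_fin => J1.
  case: (integral _ _ _) => [x| |] //= => hw.
  rewrite -EFinD -EFinM lee_fin; apply/negP; rewrite -ltNge.
  have : s / 2 * (fine (J w) + 1) < s / 2 * (1 + 1).
    by rewrite ltr_pM2l ?divr_gt0// ltrD2r.
  move=> /lt_le_trans; apply.
  move: hw; rewrite ler_norml => /andP[_ hw].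
  have := ler_norm (- x); rewrite normrN; lra.
Qed.

End admissible_consequences.

Lemma V_oo_ge d (Omega : measurableType d) (R : realType)
    (P : probability Omega R) (T : R) (B : R -> Omega -> R) : 0 < T ->
  4 <= Num.sqrt (2 * ln (1 / T)) -> brownian_motion P T B ->
  ((Num.sqrt T * (Num.sqrt (2 * ln (1 / T)) - 4))%:E <= V_oo P T B)%E.
Proof.
set u := Num.sqrt (2 * _); set s := Num.sqrt T => T0 u4 bB.
have s0 : 0 < s by rewrite sqrtr_gt0.
have sT : s ^+ 2 = T by rewrite sqr_sqrtr// ltW.
apply: le_ereal_inf_tmp => _ [alpha adm <-].
rewrite leNgt; apply/negP => hN.
have /(increment_tail_le T0 bB adm) : {ae P, forall w,
    `|terminal_value T B alpha w| <= s * (u - 4)}.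
  (* The L^oo norm is an essential supremum only when the space has positive mass, which is checked
     first. *)
  move: hN; rewrite unlock -[X in if X then _ else _]/(0 < P setT)%E.
  rewrite (probability_setT P) lte01 => /ltW/ess_supP.
  by apply: filterS => w /=; rewrite lee_fin.
rewrite -/s; case: bB => _ _ law _ _; rewrite law// subr0.
rewrite -/s; apply/negP; rewrite -ltNge.
have x0 : 0 <= s * (u - 4) + s by rewrite addr_ge0 ?mulr_ge0 ?subr_ge0// ltW.
apply: lt_le_trans (normal_prob_itv_ge s0 x0); rewrite lte_fin.
have u2 : u ^+ 2 = 2 * ln (1 / T).
  rewrite sqr_sqrtr//; have : 0 < u by lra.
  by rewrite sqrtr_gt0 => /ltW.
(* The right end of the window is [s * (u - 2)], so the exponent is [- (u - 2)^2 / 2], where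
   [u^2 / 2 = ln (1 / T)]. The tail is thus [T] times [expR (2 * u - 2)], up to a constant. *)
have -> : - (s * (u - 4) + s + s) ^+ 2 / (s ^+ 2 *+ 2) =
    2 * u - 2 - ln (1 / T).
  have -> : ln (1 / T) = u ^+ 2 / 2 by rewrite u2; field.
  by rewrite -mulr_natr; field; rewrite gt_eqF.
have lnT : ln (1 / T) = - ln T by rewrite mul1r lnV.
rewrite lnT opprK expRD lnK ?posrE//.
rewrite [X in X / Num.sqrt _]mulrC -mulrA ltr_pM2l//.
(* The shift by 4 leaves this margin: it remains to see that [2 / pi * sqrt (2 * pi) < 7], and the
   left side is at most 2. *)
have e7 : 7 <= expR (2 * u - 2) by have := expR_ge1Dx (2 * u - 2); lra.
have p2 := pi_ge2 R.
rewrite ltr_pdivlMr ?sqrtr_gt0 ?mulr_gt0 ?pi_gt0//.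
apply: lt_le_trans e7.
have p0 : 0 < Num.sqrt (2 * pi) :> R by rewrite sqrtr_gt0 mulr_gt0 ?pi_gt0.
have q : Num.sqrt (2 * pi) ^+ 2 = 2 * pi :> R.
  by rewrite sqr_sqrtr// mulr_ge0 ?pi_ge0.
rewrite mulrAC ltr_pdivrMr ?pi_gt0//.
have : Num.sqrt (2 * pi) <= pi :> R.
  by rewrite -ler_sqr ?nnegrE ?pi_ge0 ?(ltW p0)// q expr2 ler_wpM2r ?pi_ge0.
lra.
Qed.

(** * Clipping controls *)

Definition clip (R : realDomainType) (l x : R) : R := Num.max (- l) (Num.min l x).

Lemma clip_norm_le (R : realDomainType) (l x : R) : 0 <= l -> `|clip l x| <= l.
Proof.
move=> l0; rewrite ler_norml /clip le_max lexx/= ge_max ge_min lexx/= andbT.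
by rewrite (le_trans _ l0)// oppr_le0.
Qed.

Lemma clip_dist_le (R : realDomainType) (l x m : R) : 0 <= l -> `|x| <= l + m ->
  `|clip l x - x| <= Num.max 0 m.
Proof.
move=> l0; rewrite ler_norml => /andP[xl xu]; rewrite ler_norml /clip.
by rewrite /Num.max /Num.min; do ?case: ifPn => //; rewrite -?leNgt => *;
  apply/andP; split; lra.
Qed.

Lemma measurable_clip (R : realType) (l : R) : measurable_fun [set: R] (clip l).
Proof. by apply: measurable_maxr => //; exact: measurable_minr. Qed.

Section clipping_control.
Context d (Omega : measurableType d) (R : realType) (P : probability Omega R).
Variables (T : R) (B : R -> Omega -> R).
Hypothesis T0 : 0 < T.
Variables (t a : nat -> R) (S : R).
Hypothesis t0 : t 0 = 0.
Hypothesis t_inc : forall k, t k < t k.+1.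
Hypothesis t_lt : forall k, t k < T.
Hypothesis t_cvg : t n @[n --> \oo] --> T.
Hypothesis a0 : forall k, 0 <= a k.
Let L k := \sum_(j < k) a j.
Hypothesis L_le : forall k, L k <= S.

Let increment k w := B (t k.+1) w - B (t k) w.

(* The controlled process at the grid times: over [t k, t k.+1[ the drift brings
   it back to [- L k, L k] while the increment of B is added. *)
Fixpoint grid_state k w : R :=
  if k is j.+1 then clip (L j) (grid_state j w) + increment j w else 0.

Definition grid_drift k w :=
  (clip (L k) (grid_state k w) - grid_state k w) / (t k.+1 - t k).

(** The cell containing [s] is found by choice; [clipping_controlE] shows that it is unique. Within
    [[0, T]], the default 0 is taken only at [s = T]. *)
Definition clipping_control (s : R) (w : Omega) : R :=
  if pselect (exists k, t k <= s < t k.+1) is left h then grid_drift (sval (cid h)) w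
  else 0.

Let L0 k : 0 <= L k. Proof. exact: sumr_ge0. Qed.

Let t_homo : {homo t : m n / (m <= n)%N >-> m <= n}.
Proof. by apply/nondecreasing_seqP => k; exact: ltW. Qed.

Let t_ge0 k : 0 <= t k. Proof. by rewrite -t0; exact: t_homo. Qed.

Let t_in k : t k \in `[0, T].
Proof. by rewrite in_itv/= t_ge0 ltW. Qed.

Lemma clipping_controlE k s w : t k <= s < t k.+1 ->
  clipping_control s w = grid_drift k w.
Proof.
move=> /andP[ks sk]; rewrite /clipping_control; case: pselect => [h|[]]; last first.
  by exists k; rewrite ks.
case: cid => /= j /andP[js sj]; congr grid_drift.
case: (ltngtP j k) => // lt.
  by have := lt_le_trans (lt_le_trans sj (t_homo lt)) ks; rewrite ltxx.
by have := lt_le_trans (lt_le_trans sk (t_homo lt)) js; rewrite ltxx.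
Qed.

(** Adaptedness: the state only involves [B] at grid times up to [t k]. *)
Lemma measurable_grid_state u k : t k <= u ->
  measurable_fun [set: g_sigma_algebraType (natural_generators B u)] (grid_state k).
Proof.
have mB s : 0 <= s -> s <= u ->
    measurable_fun [set: g_sigma_algebraType (natural_generators B u)] (B s).
  move=> s0 su _ A mA; apply: sub_sigma_algebra; exists s.
    by rewrite /= in_itv/= s0 su.
  by exists A.
elim: k => [_|k IH ku]; first exact: measurable_cst.
have ku' : t k <= u by rewrite (le_trans _ ku)// ltW.
apply: measurable_funD; last by apply: measurable_funB; exact: mB.
exact: (measurableT_comp (@measurable_clip R (L k)) (IH ku')).
Qed.

Lemma measurable_grid_drift u k : t k <= u ->
  measurable_fun [set: g_sigma_algebraType (natural_generators B u)] (grid_drift k).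
Proof.
move=> ku; apply: measurable_funM => //; apply: measurable_funB.
  exact: (measurableT_comp (@measurable_clip R (L k)) (measurable_grid_state ku)).
exact: measurable_grid_state.
Qed.

(** The strip is cut into countably many cells, on each of which the control depends on [w] only,
    and a remainder where it is 0. A nonempty cell starts before [u], so its drift is measurable for
    the filtration at [u]. *)
Lemma clipping_control_progressive :
  progressively_measurable T B clipping_control.
Proof.
move=> u uT; set D := (X in measurable_fun X _).
have mD : measurable D by apply: measurableX.
pose E k : set (R * g_sigma_algebraType (natural_generators B u)) :=
  D `&` (`[t k, t k.+1[ `*` setT).
have mE k : measurable (E k) by apply: measurableI => //; apply: measurableX.
have -> : D = \bigcup_k E k `|` (D `\` \bigcup_k E k).
  by rewrite setUDr setDv setD0 setUidr// => x [k _ []].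
apply/measurable_funU.
- exact: bigcupT_measurable.
- by apply: measurableD => //; exact: bigcupT_measurable.
split.
- apply/measurable_fun_bigcup => // k.
  have [ku|uk] := leP (t k) u; last first.
    suff -> : E k = set0 by exact: measurable_fun_set0.
    rewrite -subset0 => -[s w] [[/=]]; rewrite !in_itv/= => /andP[_ su] _.
    by move=> [/andP[ks _] _]; have := lt_le_trans uk (le_trans ks su); rewrite ltxx.
  have mk : measurable_fun (E k) (grid_drift k \o snd).
    apply: measurable_funTS; apply: (measurableT_comp (measurable_grid_drift ku)).
    exact: measurable_snd.
  apply: eq_measurable_fun mk => -[s w]; rewrite inE => -[_ []].
  by rewrite /= in_itv/= => skt _; rewrite (clipping_controlE _ skt).
- have := @measurable_cst _ _ _ _ (D `\` \bigcup_k E k) (0 : R).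
  apply: eq_measurable_fun => -[s w]; rewrite inE => -[sD nE] /=.
  rewrite /clipping_control; case: pselect => // -[k skt].
  by case: nE; exists k => //; split=> //; split=> //=; rewrite in_itv.
Qed.

Let h_gt0 k : 0 < t k.+1 - t k. Proof. by rewrite subr_gt0. Qed.

Lemma grid_stateE k w :
  grid_state k w = B (t k) w - B 0 w +
    \sum_(j < k) (t j.+1 - t j) * grid_drift j w.
Proof.
elim: k => [|k IH]; first by rewrite t0 subrr big_ord0 addr0.
rewrite big_ord_recr/= /grid_drift mulrC divfK ?gt_eqF//.
rewrite [X in _ = _ + (X + _)](_ : _ = grid_state k w - (B (t k) w - B 0 w)).
  by rewrite /increment; ring.
by rewrite {1}IH; ring.
Qed.

(** Both the state and the level [L 0] start at 0, so nothing is corrected over the first cell. *)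
Lemma grid_drift0 w : grid_drift 0 w = 0.
Proof.
by rewrite /grid_drift /clip /L big_ord0/= oppr0 minxx maxxx addr0 mul0r.
Qed.

(** The clipped state is at most [L k] in absolute value, so the next state exceeds
    [L k.+1 = L k + a k] by at most [|increment k w| - a k]. *)
Lemma grid_drift_le k w :
  `|grid_drift k.+1 w| <=
  Num.max 0 (`|increment k w| - a k) / (t k.+2 - t k.+1).
Proof.
rewrite /grid_drift normrM normfV [X in _ / X]gtr0_norm// ler_pM2r ?invr_gt0//.
apply: clip_dist_le => //; rewrite /L big_ord_recr/= -/(L k).
rewrite [leRHS](_ : _ = L k + `|increment k w|); last by ring.
by rewrite (le_trans (ler_normD _ _))// lerD2r clip_norm_le.
Qed.

Hypothesis mB : forall t, t \in `[0, T] -> measurable_fun setT (B t).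
(** The increment over cell [k] is corrected during cell [k.+1], whence the length of the latter on
    the right. *)
Hypothesis excess_le : forall k,
  (\int[P]_w (Num.max 0 (`|increment k w| - a k) ^+ 2)%:E <=
   (2 / pi * (t k.+2 - t k.+1) ^+ 2)%:E)%E.

Let measurable_increment k : measurable_fun setT (increment k).
Proof. by apply: measurable_funB; exact: mB. Qed.

Let measurable_state k : measurable_fun [set: Omega] (grid_state k).
Proof.
elim: k => [|k IH]; first exact: measurable_cst.
by apply: measurable_funD => //; exact: measurableT_comp (@measurable_clip _ _) IH.
Qed.

Lemma clipping_control_admissible : admissible P T B clipping_control.
Proof.
split; first exact: clipping_control_progressive.
have c0 : 0 <= 2 / pi :> R by rewrite divr_ge0 ?pi_ge0.
move=> s _; apply/Lnorm2_le; rewrite ?sqrtr_ge0// sqr_sqrtr//.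
have zero (f : Omega -> R) : (forall w, f w = 0) ->
    (\int[P]_w (f w ^+ 2)%:E <= (2 / pi)%:E)%E.
  by move=> f0; rewrite integral0_eq ?lee_fin// => w _; rewrite f0 expr0n.
have [[k skt]|nk] := pselect (exists k, t k <= s < t k.+1); last first.
  by apply: zero => w; rewrite /clipping_control; case: pselect.
under eq_integral do rewrite (clipping_controlE _ skt).
case: k {skt} => [|k]; first by apply: zero => w; exact: grid_drift0.
set h := t k.+2 - t k.+1; have h0 : 0 < h by rewrite subr_gt0.
apply: (@le_trans _ _ (\int[P]_w ((h ^- 2)%:E *
    (Num.max 0 (`|increment k w| - a k) ^+ 2)%:E))%E).
  apply: ge0_le_integral => //.
  - by move=> w _; rewrite lee_fin sqr_ge0.
  - apply/measurable_EFinP; apply: measurable_funX; apply: measurable_funM => //.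
    by apply: measurable_funB => //; exact: measurableT_comp (@measurable_clip _ _) _.
  - apply: measurable_funeM; apply/measurable_EFinP; apply: measurable_funX.
    apply: measurable_maxr => //; apply: measurable_funB => //.
    exact: measurableT_comp.
  - move=> w _; rewrite -EFinM lee_fin -real_normK ?num_real//.
    apply: le_trans (_ : (Num.max 0 (`|increment k w| - a k) / h) ^+ 2 <= _).
      by rewrite ler_sqr ?nnegrE ?grid_drift_le// divr_ge0 ?le_max ?lexx// ltW.
    by rewrite expr_div_n mulrC.
rewrite ge0_integralZl//; last 3 first.
- apply/measurable_EFinP; apply: measurable_funX.
  apply: measurable_maxr => //; apply: measurable_funB => //.
  exact: measurableT_comp.
- by move=> w _; rewrite lee_fin sqr_ge0.
- by rewrite lee_fin invr_ge0 exprn_ge0// ltW.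
apply: (@le_trans _ _ ((h ^- 2)%:E * (2 / pi * h ^+ 2)%:E)%E).
  by apply: lee_wpmul2l (excess_le k); rewrite lee_fin invr_ge0 exprn_ge0// ltW.
by rewrite -EFinM lee_fin mulrC mulfK// expf_neq0// gt_eqF.
Qed.

Lemma clipping_control_integral k w :
  lebesgue_measure.-integrable `[0, T] (EFin \o clipping_control ^~ w) ->
  \int[lebesgue_measure]_(s in `[0, t k]) clipping_control s w =
  \sum_(j < k) (t j.+1 - t j) * grid_drift j w.
Proof.
move=> iw; elim: k => [|k IH].
  by rewrite t0 big_ord0 set_itv1 Rintegral_set1.
have sub x y : 0 <= x -> y <= T -> `[x, y] `<=` `[0, T].
  by move=> x0 yT; apply: subset_itv; rewrite bnd_simp.
have i1 x y : 0 <= x -> y <= T ->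
    lebesgue_measure.-integrable `[x, y] (EFin \o clipping_control ^~ w).
  by move=> x0 yT; apply: integrableS iw => //; exact: sub.
rewrite big_ord_recr/= -IH.
have := @Rintegral_itvB R (clipping_control ^~ w) (BLeft 0) (BRight (t k.+1)) (t k).
move=> /(_ (i1 _ _ (lexx _) (ltW (t_lt _)))); rewrite !bnd_simp => /(_ (t_ge0 _)).
move=> /(_ (ltW (t_inc _))) => e.
rewrite addrC -[LHS](subrK
  (\int[lebesgue_measure]_(s in `[0, t k]) clipping_control s w)).
congr (_ + _); rewrite e.
(* Endpoints are exchanged to reach the half-open cell, where the control is constant in time. *)
rewrite Rintegral_itv_obnd_cbnd; last first.
  apply: integrableS (i1 _ _ (t_ge0 k) (ltW (t_lt k.+1))) => //.
  exact: subset_itv_oc_cc.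
rewrite -Rintegral_itv_bndo_bndc; last first.
  apply: integrableS (i1 _ _ (t_ge0 k) (ltW (t_lt k.+1))) => //.
  exact: subset_itv_co_cc.
have -> : \int[lebesgue_measure]_(s in `[t k, t k.+1[) clipping_control s w =
    \int[lebesgue_measure]_(s in `[t k, t k.+1[) grid_drift k w.
  by apply: eq_Rintegral => s; rewrite inE/= in_itv/=; exact: clipping_controlE.
rewrite Rintegral_cst//= lebesgue_measure_itv/= lte_fin t_inc mulrC.
by rewrite -EFinB.
Qed.

(** By continuity of [B] and of the integral, the grid states tend to the terminal value. They
    satisfy [|grid_state n.+1 w| <= S + |increment n w|], and the increments tend to 0. *)
Lemma clipping_control_terminal_le :
  {ae P, forall w, B 0 w = 0} ->
  {ae P, forall w, {within `[0, T], continuous (B ^~ w)}} ->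
  {ae P, forall w,
    lebesgue_measure.-integrable `[0, T] (EFin \o clipping_control ^~ w)} ->
  {ae P, forall w, `|terminal_value T B clipping_control w| <= S}.
Proof.
move=> hB0 hBc hi; apply: filterS3 hB0 hBc hi => w B0 Bc iw.
have tl : t n @[n --> \oo] --> T^'-.
  move=> A /t_cvg h; change (\forall n \near \oo, A (t n)).
  by apply: filterS (h : \forall n \near \oo, t n < T -> A (t n)) => n; apply.
have cB : B (t n) w @[n --> \oo] --> B T w.
  have /(continuous_within_itvP _ T0)[_ _ cT] := Bc.
  exact: cvg_comp tl cT.
have cI : \int[lebesgue_measure]_(s in `[0, t n]) clipping_control s w
    @[n --> \oo] --> \int[lebesgue_measure]_(s in `[0, T]) clipping_control s w.
  have cT := parameterized_integral_cvg_at_left T0 iw.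
  exact: (cvg_comp (fun n => t n)
    (fun x => parameterized_integral lebesgue_measure 0 x (clipping_control ^~ w)) tl cT).
have cX : grid_state n w @[n --> \oo] --> terminal_value T B clipping_control w.
  rewrite (_ : grid_state ^~ w = fun n =>
    \int[lebesgue_measure]_(s in `[0, t n]) clipping_control s w + B (t n) w).
    exact: cvgD.
  apply/funext => n; rewrite grid_stateE clipping_control_integral// B0; ring.
have cX1 : grid_state n.+1 w @[n --> \oo] --> terminal_value T B clipping_control w.
  by move: cX; rewrite -cvg_shiftS.
have cB1 : B (t n.+1) w @[n --> \oo] --> B T w.
  by move: cB; rewrite -cvg_shiftS.
have cR : S + `|increment n w| @[n --> \oo] --> S + 0.
  apply: cvgD; first exact: cvg_cst.
  rewrite -(@normr0 _ R) -(subrr (B T w)); apply: cvg_norm; exact: cvgB.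
rewrite addr0 in cR.
apply: (ler_cvg_to (cvg_norm cX1) cR); apply: nearW => n /=.
rewrite (le_trans (ler_normD _ _))// lerD2r (le_trans (clip_norm_le _ (L0 n)))//.
Qed.

Lemma V_oo_le_clipping :
  {ae P, forall w, B 0 w = 0} ->
  {ae P, forall w, {within `[0, T], continuous (B ^~ w)}} ->
  {ae P, forall w,
    lebesgue_measure.-integrable `[0, T] (EFin \o clipping_control ^~ w)} ->
  (V_oo P T B <= S%:E)%E.
Proof.
move=> hB0 hBc hi; apply: ge_ereal_inf.
exists ('N[P]_+oo [EFin \o terminal_value T B clipping_control])%E.
  by exists clipping_control => //; exact: clipping_control_admissible.
rewrite unlock -[X in if X then _ else _]/(0 < P setT)%E.
rewrite (probability_setT P) lte01; apply/ess_supP.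
by apply: filterS (clipping_control_terminal_le hB0 hBc hi) => w; rewrite /= lee_fin.
Qed.

End clipping_control.

(** * Upper bound *)

Lemma integral_brownian_increment d (Omega : measurableType d) (R : realType)
    (P : probability Omega R) (T : R) (B : R -> Omega -> R) (s t : R)
    (f : R -> \bar R) :
  brownian_motion P T B -> 0 <= s -> s < t -> t <= T ->
  measurable_fun [set: R] f -> (forall x, 0 <= f x)%E ->
  (\int[P]_w f (B t w - B s w)%R =
   \int[normal_prob 0 (Num.sqrt (t - s))]_x f x)%E.
Proof.
move=> [mB _ law _ _] s0 st tT mf f0.
have mI : measurable_fun setT (B t \- B s).
  apply: measurable_funB; apply: mB; rewrite in_itv/=.
    by rewrite tT andbT (le_trans s0)// ltW.
  by rewrite s0 (le_trans (ltW st)).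
(* [normal_prob] is a measure on [measurableTypeR R], whose display differs from
   the one of [R]. *)
pose X : {RV P >-> measurableTypeR R} :=
  HB.pack (B t \- B s)
    (isMeasurableFun.Build _ _ Omega (measurableTypeR R) (B t \- B s) mI).
rewrite -[LHS](ge0_integral_distribution X mf f0).
by apply: eq_measure_integral => A mA _; exact: law.
Qed.

Lemma geometric_sum_le (R : realFieldType) (r : R) n : 0 <= r -> r < 1 ->
  \sum_(j < n) r ^+ j <= (1 - r)^-1.
Proof.
move=> r0 r1; rewrite -[leRHS]mul1r ler_pdivlMr ?subr_gt0//.
have -> : (\sum_(j < n) r ^+ j) * (1 - r) = 1 - r ^+ n.
  by have := subrX1 r n; lra.
by rewrite gerBl exprn_ge0.
Qed.

(** The choice of [rho] makes [a2 / (2 * h)] at least [l * 2 ^+ k], hence at least [l * (k + 1)], so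
    the exponential is at most [T ^+ k.+1]. Then [T <= r ^+ 2] absorbs [T ^+ k], and the lower bound
    on [l] absorbs the constants. *)
Lemma gauss_excess_grid_le (R : realType) (T r rho l h a2 : R) k :
  0 < r -> r < 1 -> 0 < T -> T <= r ^+ 2 ->
  rho = r ^+ 2 / 2 -> l = ln (1 / T) -> 2 <= 2 / pi * rho ^+ 2 * l ->
  h = T * rho ^+ k * (1 - rho) -> a2 = T * (2 * l) * r ^+ (k + k) ->
  4 * expR (- a2 / (2 * h)) <= 2 / pi * rho ^+ 2 * a2.
Proof.
move=> r0 r1 T0 Tr rhoE lE' hl hE a2E.
have r21 : r ^+ 2 < 1 by rewrite expr_lt1// ltW.
have rho0 : 0 < rho by rewrite rhoE divr_gt0// exprn_gt0.
have rho1 : 0 < 1 - rho by rewrite rhoE; lra.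
have l0 : 0 < l by rewrite lE' ln_gt0// mul1r invf_gt1//; lra.
have lE : expR (- l) = T by rewrite lE' mul1r lnV ?posrE// opprK lnK ?posrE.
have e1 : a2 / (2 * h) = l * 2 ^+ k / (1 - rho).
  have -> : (2 : R) ^+ k = r ^+ (k + k) / rho ^+ k.
    rewrite addnn -muln2 mulnC exprM -expr_div_n rhoE invf_div mulrA mulrC.
    by rewrite mulrA mulVf ?mul1r// expf_neq0// gt_eqF.
  by rewrite a2E hE; field; rewrite !gt_eqF ?exprn_gt0.
have e2 : expR (- a2 / (2 * h)) <= T ^+ k.+1.
  rewrite -lE -expRM_natl ler_expR mulNr e1 mulrN lerN2 mulrC.
  apply: (@le_trans _ _ (l * 2 ^+ k)).
    by rewrite ler_pM2l// -natrX ler_nat ltn_expl.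
  rewrite ler_pdivlMr// ler_piMr//.
    by rewrite mulr_ge0 ?exprn_ge0// ltW.
  by rewrite gerBl ltW.
apply: (@le_trans _ _ (4 * T ^+ k.+1)); first by rewrite ler_wpM2l.
have Tk : T ^+ k <= r ^+ (k + k).
  rewrite addnn -muln2 mulnC exprM; apply: lerXn2r; rewrite ?nnegrE ?exprn_ge0// ltW//.
have -> : 2 / pi * rho ^+ 2 * a2 = (2 / pi * rho ^+ 2 * l) * 2 * (T * r ^+ (k + k)).
  by rewrite a2E; ring.
have -> : 4 * T ^+ k.+1 = (2 * 2) * (T * T ^+ k) by rewrite exprS; ring.
apply: ler_pM; rewrite ?mulr_ge0 ?exprn_ge0 ?(ltW T0)//.
  by rewrite ler_pM2r.
by rewrite ler_pM2l.
Qed.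

Lemma V_oo_le d (Omega : measurableType d) (R : realType)
    (P : probability Omega R) (T r : R) (B : R -> Omega -> R) :
  0 < r -> r < 1 -> 0 < T -> T <= r ^+ 2 ->
  2 <= 2 / pi * (r ^+ 2 / 2) ^+ 2 * ln (1 / T) -> brownian_motion P T B ->
  (V_oo P T B <= (Num.sqrt (2 * T * ln (1 / T)) / (1 - r))%:E)%E.
Proof.
move=> r0 r1 T0 Tr hl bB.
set rho := r ^+ 2 / 2; set S := Num.sqrt _.
have r21 : r ^+ 2 < 1 by rewrite expr_lt1// ltW.
have rho0 : 0 < rho by rewrite divr_gt0// exprn_gt0.
have rho1 : 0 < 1 - rho by rewrite /rho; lra.
have l0 : 0 < ln (1 / T) by rewrite ln_gt0// mul1r invf_gt1//; lra.
have S0 : 0 < S by rewrite sqrtr_gt0 !mulr_gt0.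
pose t k := T * (1 - rho ^+ k).
pose a k := S * r ^+ k.
have tE k : t k.+1 - t k = T * rho ^+ k * (1 - rho).
  by rewrite /t exprS; ring.
have t0 : t 0%N = 0 by rewrite /t expr0 subrr mulr0.
have t_inc k : t k < t k.+1 by rewrite -subr_gt0 tE !mulr_gt0 ?exprn_gt0.
have t_lt k : t k < T by rewrite /t gtr_pMr// gtrBl exprn_gt0.
have t_ge0 k : 0 <= t k.
  rewrite mulr_ge0 ?(ltW T0)// subr_ge0 exprn_ile1 ?(ltW rho0)//.
  by rewrite -subr_ge0 ltW.
have t_cvg : t n @[n --> \oo] --> T.
  have : T * (1 - rho ^+ n) @[n --> \oo] --> T * (1 - 0).
    apply: cvgM; first exact: cvg_cst.
    apply: cvgB; first exact: cvg_cst.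
    by apply: cvg_expr; rewrite gtr0_norm// -subr_gt0.
  by rewrite subr0 mulr1.
have a0 k : 0 <= a k by rewrite mulr_ge0 ?exprn_ge0// ltW.
have a_gt0 k : 0 < a k by rewrite mulr_gt0 ?exprn_gt0.
have L_le k : \sum_(j < k) a j <= S / (1 - r).
  by rewrite -mulr_sumr ler_pM2l// geometric_sum_le// ltW.
have mB : forall s, s \in `[0, T] -> measurable_fun setT (B s) by case: bB.
have excess k : (\int[P]_w
    (Num.max 0 (`|B (t k.+1) w - B (t k) w| - a k) ^+ 2)%:E <=
    (2 / pi * (t k.+2 - t k.+1) ^+ 2)%:E)%E.
  have mf : measurable_fun [set: R] (fun y : R => (Num.max 0 (`|y| - a k) ^+ 2)%:E).
    apply/measurable_EFinP; apply: measurable_funX; apply: measurable_maxr => //.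
    by apply: measurable_funB => //; exact: measurable_normr.
  rewrite (integral_brownian_increment bB (t_ge0 k) (t_inc k) (ltW (t_lt _)) mf)//;
    last by move=> y; rewrite lee_fin sqr_ge0.
  set s := Num.sqrt _.
  have h0 : 0 < t k.+1 - t k by rewrite subr_gt0.
  have s0 : 0 < s by rewrite sqrtr_gt0.
  have s2 : s ^+ 2 = t k.+1 - t k by rewrite sqr_sqrtr// ltW.
  apply: le_trans (normal_prob_excess_le s0 (a_gt0 k)) _; rewrite lee_fin.
  have -> : s ^+ 4 = (s ^+ 2) ^+ 2 by rewrite -exprM.
  (* The next cell is shorter by the factor [rho]; the square of the cell length then cancels on
     both sides. *)
  have -> : t k.+2 - t k.+1 = rho * (t k.+1 - t k) by rewrite !tE exprS; ring.
  rewrite s2 -[(_ - _) *+ 2]mulr_natl.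
  have a2E : a k ^+ 2 = T * (2 * ln (1 / T)) * r ^+ (k + k).
    rewrite /a exprMn sqr_sqrtr; last by rewrite !mulr_ge0// ltW.
    by rewrite -exprM muln2 addnn; ring.
  have := gauss_excess_grid_le r0 r1 T0 Tr erefl erefl hl (tE k) a2E.
  rewrite -/rho; set h := t k.+1 - t k; set e := expR _ => he.
  have a20 : 0 < a k ^+ 2 by rewrite exprn_gt0.
  rewrite [leLHS](_ : _ = 4 * e * h ^+ 2 / a k ^+ 2); last by ring.
  rewrite ler_pdivrMr//.
  rewrite [leRHS](_ : _ = 2 / pi * rho ^+ 2 * a k ^+ 2 * h ^+ 2); last by ring.
  by rewrite ler_wpM2r ?sqr_ge0.
(* Admissibility comes first, since it yields the almost sure integrability required for the
   terminal bound. *)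
have adm := clipping_control_admissible t0 t_inc t_lt a0 mB excess.
have [_ B0 _ _ Bc] := bB.
apply: (V_oo_le_clipping T0 t0 t_inc t_lt t_cvg a0 L_le mB excess B0 Bc).
exact: (admissible_integrable T0 bB adm).
Qed.

(** * Two-sided bounds on the ratio and passage to the limit *)

(** The threshold is uniform over probability spaces and Brownian motions, since these may change
    with [T] in the theorem. *)
Lemma V_oo_ratio_bounds (R : realType) (e : R) : 0 < e ->
  exists2 dlt : R, 0 < dlt & forall (T : R) d (Omega : measurableType d)
      (P : probability Omega R) (B : R -> Omega -> R),
    0 < T -> T < dlt -> brownian_motion P T B ->
    ((1 - e)%:E <= V_oo P T B / (Num.sqrt (2 * T * ln (1 / T)))%:E <= (1 + e)%:E)%E.
Proof.
(* Solves [1 / (1 - r) = 1 + e]. *)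
move=> e0; pose r := e / (1 + e).
have r0 : 0 < r by rewrite divr_gt0// addr_gt0.
have r1 : r < 1 by rewrite ltr_pdivrMr ?addr_gt0// mul1r ltrDr.
have rE : (1 - r)^-1 = 1 + e.
  by rewrite /r; field; rewrite addrK oner_neq0 gt_eqF // addr_gt0.
pose c : R := 2 / pi * (r ^+ 2 / 2) ^+ 2.
have c0 : 0 < c by rewrite mulr_gt0 ?divr_gt0 ?pi_gt0// !exprn_gt0// divr_gt0 ?exprn_gt0.
(* The first term gives the smallness condition of [V_oo_le]. The second gives [u >= 4 + 4 / e],
   hence both [u >= 4] and [4 / u <= e] for the lower bound. *)
pose M := 2 / c + (4 + 4 / e) ^+ 2 / 2.
exists (Num.min (r ^+ 2) (expR (- M))); first by rewrite lt_min exprn_gt0//= expR_gt0.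
move=> T d Omega P B T0; rewrite lt_min => /andP[/ltW Tr /ltW TM] bB.
have ML : M <= ln (1 / T).
  rewrite mul1r lnV ?posrE// lerNr -[leRHS]expRK ler_ln ?posrE//.
  exact: expR_gt0.
have e4 : 0 < 4 / e by rewrite divr_gt0.
have l0 : 0 < ln (1 / T).
  by apply: lt_le_trans ML; rewrite addr_gt0 ?divr_gt0 ?exprn_gt0// addr_gt0.
have cl : 2 <= c * ln (1 / T).
  rewrite [c * _]mulrC -ler_pdivrMr//; apply: le_trans ML.
  by rewrite lerDl divr_ge0 ?sqr_ge0.
set u := Num.sqrt (2 * ln (1 / T)).
have u4 : 4 + 4 / e <= u.
  rewrite -(ger0_norm (_ : 0 <= 4 + 4 / e)); last by rewrite addr_ge0 ?ltW.
  rewrite -sqrtr_sqr ler_wsqrtr// [2 * _]mulrC -ler_pdivrMr//; apply: le_trans ML.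
  by rewrite lerDr divr_ge0 ?ltW.
have SE : Num.sqrt (2 * T * ln (1 / T)) = Num.sqrt T * u.
  by rewrite -sqrtrM ?(ltW T0)//; congr Num.sqrt; ring.
have s0 : 0 < Num.sqrt T by rewrite sqrtr_gt0.
have u0 : 0 < u by rewrite (lt_le_trans _ u4)// addr_gt0.
have Sinv : (((Num.sqrt (2 * T * ln (1 / T)))%:E)^-1 =
    ((Num.sqrt (2 * T * ln (1 / T)))^-1)%:E)%E.
  by rewrite inver gt_eqF// SE mulr_gt0.
rewrite Sinv; have S0 : 0 < Num.sqrt (2 * T * ln (1 / T)) by rewrite SE mulr_gt0.
apply/andP; split.
  rewrite lee_pdivlMr//; apply: le_trans (V_oo_ge T0 _ bB); last first.
    by rewrite (le_trans _ u4)// lerDl ltW.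
  rewrite -EFinM lee_fin SE mulrCA ler_pM2l// -/u mulrBl mul1r lerB//.
  by rewrite [e * _]mulrC -ler_pdivrMr// (le_trans _ u4)// lerDr.
rewrite lee_pdivrMr//; apply: le_trans (V_oo_le r0 r1 T0 Tr cl bB) _.
by rewrite rE -EFinM mulrC.
Qed.

Theorem mainTheorem2 (R : realType) (d : R -> measure_display)
    (Omega : forall T : R, measurableType (d T))
    (P : forall T : R, probability (Omega T) R)
    (B : forall T : R, R -> Omega T -> R)
    (hB : forall T : R, 0 < T -> brownian_motion (P T) T (B T)) :
  (V_oo (P T) T (B T) / (Num.sqrt (2 * T * ln (1 / T)))%:E)%E
    @[T --> 0^'+] --> 1%:E.
Proof.
set q := fun T : R => _.
have bnd (e : R) : 0 < e ->
    \forall T \near 0^'+, ((1 - e)%:E <= q T <= (1 + e)%:E)%E.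
  move=> /V_oo_ratio_bounds[dlt dlt0 h]; near=> T.
  have T0 : 0 < T by near: T; exact: nbhs_right_gt.
  by apply: (h _ _ _ _ _ T0 _ (hB T T0)); near: T; exact: nbhs_right_lt.
apply/fine_cvgP; split.
  (* Any fixed tolerance shows that the ratio is eventually finite. *)
  apply: filterS (bnd 1 ltr01) => T /andP[h1 h2].
  by rewrite fin_numElt (lt_le_trans _ h1) ?ltNyr// (le_lt_trans h2) ?ltry.
apply/cvgrPdist_le => e e0; apply: filterS (bnd e e0) => T /andP[] /=.
case: (q T) => [x| |]//=; rewrite !lee_fin => h1 h2.
by rewrite ler_norml; apply/andP; split; lra.
Unshelve. all: by end_near. Qed.
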